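(* Let $H$, $J$, $A$ and the Dirac operator $D=D_0+D_1+D_R$ be as in the context, and suppose $\delta_{21}=0$ and $\beta_{13}=\beta_{14}=0$. Then the Hodge property $\mathcal{C}\ell_D(A)'=\mathcal{C}\ell_D(A)^\circ$ holds if and only if $(\beta_{23},\beta_{24})\neq(0,0)$ and at least three of the four vectors $(\alpha_{13},\alpha_{14})$, $(\alpha_{23},\alpha_{24})$, $(\delta_{12},\delta_{13},\delta_{14})$, $(\delta_{22},\delta_{23},\delta_{24})$ are non-zero.
   Context: Let $H=M_4(\mathbb{C})\oplus M_4(\mathbb{C})$, with elements written as pairs $(v,w)$ and inner product $\langle (v,w),(v',w')\rangle=\mathrm{Tr}(v^*v')+\mathrm{Tr}(w^*w')$. Let $J$ be the antilinear isometry $J(v,w)=(w^*,v^* )$. Identify $\mathrm{End}_{\mathbb{C}}(H)$ with $M_4(\mathbb{C})\otimes M_2(\mathbb{C})\otimes M_4(\mathbb{C})$ via $\big(x\otimes\begin{bmatrix}a&b\\c&d\end{bmatrix}\otimes y\big)(v,w)=\big(x(av+bw)y^t,\ x(cv+dw)y^t\big)$. Here $e_{ij}$ denotes the matrix unit with $1$ in position $(i,j)$ (size clear from context) and $1$ the identity matrix. Let $A\cong\mathbb{C}\oplus\mathbb{H}\oplus M_3(\mathbb{C})$ be the real $*$-algebra of operators $\mathrm{diag}(\lambda,\bar\lambda,q)\otimes e_{11}\otimes 1+\mathrm{diag}(\lambda,m)\otimes e_{22}\otimes 1$, where $\lambda\in\mathbb{C}$, $q$ is a quaternion viewed as a $2\times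 2$ complex matrix $\begin{bmatrix}z&w\\-\bar w&\bar z\end{bmatrix}$, $m\in M_3(\mathbb{C})$, and $\mathrm{diag}$ denotes block-diagonal $4\times4$ matrices. Fix complex parameters $\alpha_{ij},\beta_{ij}$ ($i\in\{1,2\}$, $j\in\{3,4\}$), $\delta_{12},\delta_{13},\delta_{14},\delta_{21},\delta_{22},\delta_{23},\delta_{24}$ and $\Upsilon_R$. Put $\alpha=\begin{bmatrix}\alpha_{13}&\alpha_{14}\\ \alpha_{23}&\alpha_{24}\end{bmatrix}$, $\beta=\begin{bmatrix}\beta_{13}&\beta_{14}\\ \beta_{23}&\beta_{24}\end{bmatrix}$, $X_\alpha=\begin{bmatrix}0&\alpha\\ \alpha^*&0\end{bmatrix}\in M_4(\mathbb{C})$ (in $2\times2$ blocks), $X_\beta$ likewise, and $Y\in M_4(\mathbb{C})$ the matrix with first row $(0,\delta_{12},\delta_{13},\delta_{14})$, second row $(\delta_{21},\delta_{22},\delta_{23},\delta_{24})$ and zero third and fourth rows. Define $D_0=X_\alpha\otimes e_{11}\otimes e_{11}+X_\beta\otimes e_{11}\otimes(1-e_{11})+Y\otimes e_{12}\otimes e_{11}+Y^*\otimes e_{21}\otimes e_{11}$, $D_1=JD_0J^{-1}$, $D_R=e_{11}\otimes(\Upsilon_R e_{21}+\overline{\Upsilon}_R e_{12})\otimes e_{11}$, and $D=D_0+D_1+D_R$. For $\xi\in\mathrm{End}_{\mathbb{C}}(H)$ set $\xi^\circ=J\xi^*J^{-1}$, and for a subset $S$ set $S^\circ=\{\xi^\circ:\xi\in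 S\}$ and $S'=\{\xi\in\mathrm{End}_{\mathbb{C}}(H): [\xi,\eta]=0\ \forall\eta\in S\}$. $\mathcal{C}\ell_D(A)$ is the complex $*$-subalgebra of $\mathrm{End}_{\mathbb{C}}(H)$ generated by $A$ and the operators $a[D,b]$, $a,b\in A$. The Hodge property means $\mathcal{C}\ell_D(A)'=\mathcal{C}\ell_D(A)^\circ$. *)

(* Defs.v *)
From HB Require Import structures.
From mathcomp Require Import all_boot all_order all_algebra.
From mathcomp Require Import complex.
From mathcomp Require Import reals.
Set Implicit Arguments. Unset Strict Implicit. Unset Printing Implicit Defensive.
Import Order.TTheory GRing.Theory Num.Theory.
Local Open Scope ring_scope.
Local Open Scope complex_scope.

Notation Cx R := (R[i]) (only parsing).

Definition mconj {R : realType} {m n} (A : 'M[R[i]]_(m, n)) : 'M[R[i]]_(m, n) :=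
  map_mx (@conjc R) A.
Definition mdag {R : realType} {m n} (A : 'M[R[i]]_(m, n)) : 'M[R[i]]_(n, m) :=
  (mconj A)^T.

Definition Hsp (R : realType) := ('M[R[i]]_4 * 'M[R[i]]_4)%type.

Notation N := (4 * 4 + 4 * 4)%N.

(* Coordinates of H in the orthonormal basis (for <(v,w),(v',w')> =
   Tr(v^* v') + Tr(w^* w')) given by the matrix units of both summands. *)
Definition vecH {R : realType} (h : Hsp R) : 'cV[R[i]]_N :=
  col_mx (mxvec h.1)^T (mxvec h.2)^T.
Definition unvecH {R : realType} (x : 'cV[R[i]]_N) : Hsp R :=
  (vec_mx (usubmx x)^T, vec_mx (dsubmx x)^T).

(* End_C(H) is represented by 'M_N acting on coordinates. *)
Definition actH {R : realType} (T : 'M[R[i]]_N) (h : Hsp R) : Hsp R :=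
  unvecH (T *m vecH h).

(* The matrix (in the above basis) of a map f : H -> H (f C-linear). *)
Definition mx_of {R : realType} (f : Hsp R -> Hsp R) : 'M[R[i]]_N :=
  \matrix_(i < N, j < N) (vecH (f (unvecH (delta_mx j 0)))) i 0.

(* The identification M_4 (x) M_2 (x) M_4 ~ End(H):
   (x (x) [a b; c d] (x) y)(v,w) = (x(av+bw)y^t, x(cv+dw)y^t). *)
Definition tens {R : realType} (x : 'M[R[i]]_4) (m : 'M[R[i]]_2) (y : 'M[R[i]]_4)
  : 'M[R[i]]_N :=
  mx_of (fun h : Hsp R =>
    (x *m (m 0 0 *: h.1 + m 0 1 *: h.2) *m y^T,
     x *m (m 1 0 *: h.1 + m 1 1 *: h.2) *m y^T)).

(* The antilinear isometry J(v,w) = (w^* , v^* ) (J is an involution, J^{-1} = J). *)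
Definition Jop {R : realType} (h : Hsp R) : Hsp R := (mdag h.2, mdag h.1).
Definition Jinv {R : realType} (h : Hsp R) : Hsp R := (mdag h.2, mdag h.1).

(* Adjoint of an operator: the conjugate transpose, since the basis is
   orthonormal for the inner product of H. *)
Definition opadj {R : realType} (T : 'M[R[i]]_N) : 'M[R[i]]_N := mdag T.

Definition Jconj {R : realType} (T : 'M[R[i]]_N) : 'M[R[i]]_N :=
  mx_of (fun h => Jop (actH T (Jinv h))).

Definition opp_op {R : realType} (T : 'M[R[i]]_N) : 'M[R[i]]_N :=
  Jconj (opadj T).

(* matrix units e_ij (0-based indices here: e 0 0 is e_11) *)
Definition eu {R : realType} {n} (i j : 'I_n) : 'M[R[i]]_n := delta_mx i j.

Definition mx4 {R : realType} (l : seq (seq R[i])) : 'M[R[i]]_4 :=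
  \matrix_(i < 4, j < 4) nth 0 (nth [::] l i) j.

Definition diag1 {R : realType} (lam z w : R[i]) : 'M[R[i]]_4 :=
  mx4 [:: [:: lam; 0; 0; 0];
          [:: 0; lam^*; 0; 0];
          [:: 0; 0; z; w];
          [:: 0; 0; - w^*; z^*]].

Definition diag2 {R : realType} (lam : R[i]) (m : 'M[R[i]]_3) : 'M[R[i]]_4 :=
  \matrix_(i < 4, j < 4)
    if (i == 0 :> nat) && (j == 0 :> nat) then lam
    else if (0 < i)%N && (0 < j)%N then m (inord i.-1) (inord j.-1) else 0.

(* The real *-algebra A ~ C (+) H (+) M_3(C) *)
Definition inA {R : realType} (T : 'M[R[i]]_N) : Prop :=
  exists (lam z w : R[i]) (m : 'M[R[i]]_3),
    T = tens (diag1 lam z w) (eu 0 0) 1%:M + tens (diag2 lam m) (eu 1 1) 1%:M.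

Definition Xmat {R : realType} (a13 a14 a23 a24 : R[i]) : 'M[R[i]]_4 :=
  mx4 [:: [:: 0; 0; a13; a14];
          [:: 0; 0; a23; a24];
          [:: a13^*; a23^*; 0; 0];
          [:: a14^*; a24^*; 0; 0]].

Definition Ymat {R : realType} (d12 d13 d14 d21 d22 d23 d24 : R[i]) : 'M[R[i]]_4 :=
  mx4 [:: [:: 0; d12; d13; d14];
          [:: d21; d22; d23; d24];
          [:: 0; 0; 0; 0];
          [:: 0; 0; 0; 0]].

Definition D0 {R : realType}
  (a13 a14 a23 a24 b13 b14 b23 b24 d12 d13 d14 d21 d22 d23 d24 : R[i]) : 'M[R[i]]_N :=
  let Y := Ymat d12 d13 d14 d21 d22 d23 d24 in
  tens (Xmat a13 a14 a23 a24) (eu 0 0) (eu 0 0)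
  + tens (Xmat b13 b14 b23 b24) (eu 0 0) (1%:M - eu 0 0)
  + tens Y (eu 0 1) (eu 0 0)
  + tens (mdag Y) (eu 1 0) (eu 0 0).

Definition DR {R : realType} (ups : R[i]) : 'M[R[i]]_N :=
  tens (eu 0 0) (ups *: eu 1 0 + ups^* *: eu 0 1) (eu 0 0).

Definition Dirac {R : realType}
  (a13 a14 a23 a24 b13 b14 b23 b24 d12 d13 d14 d21 d22 d23 d24 ups : R[i])
  : 'M[R[i]]_N :=
  let D0' := D0 a13 a14 a23 a24 b13 b14 b23 b24 d12 d13 d14 d21 d22 d23 d24 in
  D0' + Jconj D0' + DR ups.

Inductive gen_salg {R : realType} (S : 'M[R[i]]_N -> Prop) : 'M[R[i]]_N -> Prop :=
  | gen_base T : S T -> gen_salg S T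
  | gen_add T U : gen_salg S T -> gen_salg S U -> gen_salg S (T + U)
  | gen_scale (c : R[i]) T : gen_salg S T -> gen_salg S (c *: T)
  | gen_mul T U : gen_salg S T -> gen_salg S U -> gen_salg S (T * U)
  | gen_adj T : gen_salg S T -> gen_salg S (opadj T).

Definition Cl_gens {R : realType} (D : 'M[R[i]]_N) (T : 'M[R[i]]_N) : Prop :=
  inA T \/ exists a b, inA a /\ inA b /\ T = a * (D * b - b * D).

Definition ClD {R : realType} (D : 'M[R[i]]_N) : 'M[R[i]]_N -> Prop :=
  gen_salg (Cl_gens D).

Definition commutant {R : realType} (S : 'M[R[i]]_N -> Prop) (T : 'M[R[i]]_N) : Prop :=
  forall U, S U -> T * U = U * T.

Definition opp_set {R : realType} (S : 'M[R[i]]_N -> Prop) (T : 'M[R[i]]_N) : Prop :=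
  exists U, S U /\ T = opp_op U.

Definition Hodge {R : realType} (D : 'M[R[i]]_N) : Prop :=
  forall T, commutant (ClD D) T <-> opp_set (ClD D) T.

(* Main.v *)
(** Write H as the span of the matrix units (s, i, j), where s selects one of
    the two summands.  When delta_21 = beta_13 = beta_14 = 0, H splits into four
    blocks K (x) M on which Cl_D(A) acts through K only; J interchanges the
    roles of K and M.  Operators acting through the K's and operators acting
    through the M's are each other's commutants, so the Hodge property says
    exactly that Cl_D(A) contains every operator acting through the K's.
    Since D_1 and D_R commute with A, Cl_D(A) is generated by A and the
    off-diagonal parts of D_0.  These generate all matrix units precisely when
    the graph with vertices u_1, u_2, {u_3, u_4}, {d_2, d_3, d_4} (u = first
    summand, d = second) and one edge for each non-zero alpha_i, delta_i is
    connected and beta joins u_2 to {u_3, u_4}.  The graph is a 4-cycle, hence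
    connected iff at least three edges survive; otherwise a colouring constant
    on components gives a projection in the commutant that is not in the
    opposite algebra. *)

Require Import Defs.
From HB Require Import structures.
From mathcomp Require Import all_boot all_order all_algebra.
From mathcomp Require Import complex.
From mathcomp Require Import reals.
Local Open Scope ring_scope.
Local Open Scope complex_scope.
Set Implicit Arguments. Unset Strict Implicit. Unset Printing Implicit Defensive.
Import GRing.Theory.

(** * Indexing the basis of matrix units *)

(** The index (s, i, j) stands for the matrix unit e_ij in summand s of H. *)
Notation idx := ('I_2 * 'I_4 * 'I_4)%type.

Definition pos (p : idx) : 'I_N :=
  let: (s, i, j) := p in
  if s == 0 then lshift (4 * 4) (mxvec_index i j)
  else rshift (4 * 4) (mxvec_index i j).

Definition unpos (k : 'I_N) : idx :=
  match split k with
  | inl a => (0, (enum_val (cast_ord (esym (mxvec_cast 4 4)) a)).1,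
                 (enum_val (cast_ord (esym (mxvec_cast 4 4)) a)).2)
  | inr a => (1, (enum_val (cast_ord (esym (mxvec_cast 4 4)) a)).1,
                 (enum_val (cast_ord (esym (mxvec_cast 4 4)) a)).2)
  end.

Lemma ord2P (P : 'I_2 -> Prop) : P 0 -> P 1 -> forall s, P s.
Proof.
move=> P0 P1 [[|[|//]] h].
- by rewrite (_ : Ordinal h = 0) //; apply: val_inj.
- by rewrite (_ : Ordinal h = 1) //; apply: val_inj.
Qed.

Lemma ord4P (P : 'I_4 -> Prop) :
  P 0 -> P 1 -> P (@Ordinal 4 2 isT) -> P (@Ordinal 4 3 isT) -> forall i, P i.
Proof.
move=> P0 P1 P2 P3 [[|[|[|[|//]]]] h].
- by rewrite (_ : Ordinal h = 0) //; apply: val_inj.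
- by rewrite (_ : Ordinal h = 1) //; apply: val_inj.
- by rewrite (_ : Ordinal h = @Ordinal 4 2 isT) //; apply: val_inj.
- by rewrite (_ : Ordinal h = @Ordinal 4 3 isT) //; apply: val_inj.
Qed.

Lemma posK : cancel pos unpos.
Proof.
have K (i j : 'I_4) :
  enum_val (cast_ord (esym (mxvec_cast 4 4)) (mxvec_index i j)) = (i, j).
  by rewrite /mxvec_index cast_ordK enum_rankK.
move=> [[s i] j]; elim/ord2P: s; rewrite /pos /unpos /=.
- by rewrite (unsplitK (inl _)) K.
- by rewrite (unsplitK (inr _)) K.
Qed.

Lemma unposK : cancel unpos pos.
Proof.
move=> k; rewrite /unpos; case: split_ordP => a ->;
  by case/mxvec_indexP: a => i j; rewrite /mxvec_index cast_ordK enum_rankK.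
Qed.

Lemma pos_bij : bijective pos.
Proof. by exists unpos; [exact: posK|exact: unposK]. Qed.

Lemma pos_eq p q : (pos p == pos q) = (p == q).
Proof. exact: (inj_eq (can_inj posK)). Qed.

(** * Operators through their matrix entries *)

Section Coordinates.
Variable R : realType.
Local Notation C := R[i].
Local Notation op := 'M[C]_N.
Implicit Types (T U : op) (p q r : idx).

Definition ent T p q : C := T (pos p) (pos q).

Lemma ent_inj T U : (forall p q, ent T p q = ent U p q) -> T = U.
Proof.
move=> h; apply/matrixP => a b; rewrite -(unposK a) -(unposK b); exact: h.
Qed.

Definition op_of (f : idx -> idx -> C) : op :=
  \matrix_(a, b) f (unpos a) (unpos b).

Lemma ent_op_of f p q : ent (op_of f) p q = f p q.
Proof. by rewrite /ent mxE !posK. Qed.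

Lemma entD T U p q : ent (T + U) p q = ent T p q + ent U p q.
Proof. by rewrite /ent mxE. Qed.

Lemma entN T p q : ent (- T) p q = - ent T p q.
Proof. by rewrite /ent mxE. Qed.

Lemma entZ c T p q : ent (c *: T) p q = c * ent T p q.
Proof. by rewrite /ent mxE. Qed.

Lemma ent_sum (J : finType) (P : pred J) (F : J -> op) p q :
  ent (\sum_(k | P k) F k) p q = \sum_(k | P k) ent (F k) p q.
Proof. by rewrite /ent summxE. Qed.

Lemma entM T U p q : ent (T * U) p q = \sum_r ent T p r * ent U r q.
Proof.
rewrite /ent mxE (reindex pos) //=; exact: onW_bij pos_bij.
Qed.

Lemma ent_adj T p q : ent (opadj T) p q = (ent T q p)^*.
Proof. by rewrite /ent !mxE. Qed.

Lemma vecH_pos (h : Hsp R) s i j :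
  vecH h (pos (s, i, j)) 0 = (if s == 0 then h.1 else h.2) i j.
Proof.
by rewrite /vecH /pos; case: ifP => _; rewrite ?col_mxEu ?col_mxEd mxE mxvecE.
Qed.

Lemma unvecHK : cancel (@unvecH R) (@vecH R).
Proof. by move=> x; rewrite /vecH /unvecH /= !vec_mxK !trmxK vsubmxK. Qed.

Lemma vecHK : cancel (@vecH R) (@unvecH R).
Proof.
by case=> v w; rewrite /vecH /unvecH /= col_mxKu col_mxKd !trmxK !mxvecK.
Qed.

Definition basisH p : Hsp R :=
  let: (s, i, j) := p in
  if s == 0 then (delta_mx i j, 0) else (0, delta_mx i j).

Lemma vecH_basis p : vecH (basisH p) = delta_mx (pos p) 0.
Proof.
apply/colP => a; rewrite -(unposK a) [RHS]mxE pos_eq eqxx andbT.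
case: (unpos a) p => [[s i] j] [[s' i'] j']; rewrite vecH_pos.
by elim/ord2P: s; elim/ord2P: s'; rewrite /= !mxE.
Qed.

Lemma unvecH_delta p : unvecH (delta_mx (pos p) 0) = basisH p.
Proof. by rewrite -vecH_basis vecHK. Qed.

Lemma ent_mx_of (f : Hsp R -> Hsp R) s i j q :
  ent (mx_of f) (s, i, j) q =
  (if s == 0 then (f (basisH q)).1 else (f (basisH q)).2) i j.
Proof. by rewrite /ent mxE unvecH_delta vecH_pos. Qed.

Lemma ent_tens x m y s i j s' i' j' :
  ent (@tens R x m y) (s, i, j) (s', i', j') = x i i' * m s s' * y j j'.
Proof.
have K c : (x *m (c *: delta_mx i' j') *m y^T) i j = x i i' * c * y j j'.
  (* A matrix unit is a column times a row, so the product splits into a column of [x] and a row of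
     [y^T]. *)
  rewrite -(mul_delta_mx (0 : 'I_1)) -scalemxAr -scalemxAl mxE mulmxA -colE.
  by rewrite -mulmxA -rowE !mxE big_ord1 !mxE mulrCA mulrA.
rewrite /tens ent_mx_of.
by elim/ord2P: s; elim/ord2P: s'; rewrite /= ?scaler0 ?add0r ?addr0 K.
Qed.

(** The permutation of the basis underlying the antilinear map J. *)
Definition flip p : idx := let: (s, i, j) := p in (rev_ord s, j, i).

Lemma flipK : involutive flip.
Proof. by case=> [[s i] j]; rewrite /flip rev_ordK. Qed.

Lemma ent_Jconj T p q : ent (Jconj T) p q = (ent T (flip p) (flip q))^*.
Proof.
case: p => [[s i] j]; rewrite ent_mx_of.
have -> : Jinv (basisH q) = basisH (flip q).
  case: q => [[s' i'] j']; elim/ord2P: s'; rewrite /Jinv /=; congr pair;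
    apply/matrixP => a b; rewrite !mxE ?conjc0 // andbC.
  1,2: by rewrite (rmorph_nat (@conjc R)).
have K s0 i0 j0 : ent T (s0, i0, j0) (flip q) =
    (if s0 == 0 then (actH T (basisH (flip q))).1
     else (actH T (basisH (flip q))).2) i0 j0.
  by rewrite -vecH_pos /actH unvecHK vecH_basis -colE mxE.
by rewrite K; elim/ord2P: s; rewrite /Jop /= !mxE.
Qed.

End Coordinates.

(** ** The decomposition of H into blocks K (x) M *)

(** With 0-based indices, block 0 is {u_i r_0, d_i r_0} \ {d_0 r_0} (K of
    dimension 7, M a line), block 1 is its image under [flip] (K a line), and
    blocks 2 and 3 are {u_i r_j} and {d_i r_j} with i, j <> 0 (K = M = C^3);
    here u_i r_j is (0, i, j) and d_i r_j is (1, i, j).  [llab] and [rlab] are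
    the coordinates of a basis vector in K and in M, each tagged with the block
    by using basis vectors as labels. *)
Definition blk (p : idx) : nat :=
  let: (s, i, j) := p in
  if s == 0 then (if j == 0 then 0%N else if i == 0 then 1%N else 2%N)
  else (if i == 0 then 1%N else if j == 0 then 0%N else 3%N).

Definition llab (p : idx) : idx :=
  let: (s, i, j) := p in
  match blk p with 0%N => p | 1%N => (1, 0, 0) | _ => (s, i, 1) end.

Definition rlab (p : idx) : idx :=
  let: (s, i, j) := p in
  match blk p with 0%N => (0, 0, 0) | 1%N => p | _ => (s, 1, j) end.

(** The basis vector with the K-coordinate of p and the M-coordinate of q. *)
Definition mix (p q : idx) : idx :=
  let: (s, i, j) := p in
  match blk p with 0%N => p | 1%N => q | _ => (s, i, q.2) end.

(** The case analysis behind the block arguments: block 0, block 1, and blocks 2 and 3 together. The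
    suffixes [W], [V], [U] of later names refer to these three cases. *)
Lemma blkP (P : idx -> Prop) :
  (forall s i, (s == 0) || (i != 0) -> P (s, i, 0)) ->
  (forall s i j, (s == 0) && (i == 0) && (j != 0) || (s == 1) && (i == 0) ->
     P (s, i, j)) ->
  (forall s i j, i != 0 -> j != 0 -> P (s, i, j)) ->
  forall p, P p.
Proof.
move=> PW PV PU [[s i] j]; elim/ord2P: s;
  have [->|i0] := eqVneq i 0; have [->|j0] := eqVneq j 0;
  by [apply: PW|apply: PV|apply: PU|apply: PV; rewrite /= ?i0 ?j0
     |apply: PW; rewrite i0 orbT].
Qed.

Lemma blkW s i : (s == 0) || (i != 0) -> blk (s, i, 0) = 0%N.
Proof. by elim/ord2P: s => //= /negPf ->. Qed.

Lemma blkV s i j :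
  (s == 0) && (i == 0) && (j != 0) || (s == 1) && (i == 0) ->
  blk (s, i, j) = 1%N.
Proof. by elim/ord2P: s => /=; rewrite ?orbF; [case/andP=> -> /negPf ->|move->]. Qed.

Lemma blkU s i j : i != 0 -> j != 0 -> blk (s, i, j) = (2 + (s != 0%R))%N.
Proof. by elim/ord2P: s => /= /negPf -> /negPf ->. Qed.

Lemma llab_blk p : blk (llab p) = blk p.
Proof.
elim/blkP: p => [s i h|s i j h|s i j hi hj]; rewrite /llab.
- by rewrite !(blkW h).
- by rewrite (blkV h).
- by rewrite !blkU //; elim/ord2P: s.
Qed.

Lemma rlab_blk p : blk (rlab p) = blk p.
Proof.
elim/blkP: p => [s i h|s i j h|s i j hi hj]; rewrite /rlab.
- by rewrite !(blkW h).
- by rewrite !(blkV h).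
- by rewrite !blkU //; elim/ord2P: s.
Qed.

Lemma llab_id p : llab (llab p) = llab p.
Proof.
elim/blkP: p => [s i h|s i j h|s i j hi hj]; rewrite /llab.
- by rewrite !(blkW h).
- by rewrite (blkV h).
- by rewrite !blkU //; elim/ord2P: s.
Qed.

Lemma rlab_id p : rlab (rlab p) = rlab p.
Proof.
elim/blkP: p => [s i h|s i j h|s i j hi hj]; rewrite /rlab.
- by rewrite (blkW h).
- by rewrite !(blkV h).
- by rewrite !blkU //; elim/ord2P: s.
Qed.

(** [llab] replaces the M-coordinate by a reference vector that depends on the block alone. *)
Lemma rlab_llab p q : blk p = blk q -> rlab (llab p) = rlab (llab q).
Proof.
suff E r : rlab (llab r) = match blk r with 0%N => (0, 0, 0) | 1%N => (1, 0, 0)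
                         | 2%N => (0, 1, 1) | _ => (1, 1, 1) end.
  by rewrite !E => ->.
elim/blkP: r => [s i h|s i j h|s i j hi hj]; rewrite {1}/llab.
- by rewrite (blkW h) /rlab (blkW h).
- by rewrite (blkV h).
- by rewrite !blkU //=; elim/ord2P: s; rewrite /= (negPf hi).
Qed.

Lemma llab_rlab p q : blk p = blk q -> llab (rlab p) = llab (rlab q).
Proof.
suff E r : llab (rlab r) = match blk r with 0%N => (0, 0, 0) | 1%N => (1, 0, 0)
                         | 2%N => (0, 1, 1) | _ => (1, 1, 1) end.
  by rewrite !E => ->.
elim/blkP: r => [s i h|s i j h|s i j hi hj]; rewrite {1}/rlab.
- by rewrite (blkW h).
- by rewrite (blkV h) /llab (blkV h).
- by rewrite !blkU //=; elim/ord2P: s; rewrite /= (negPf hj).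
Qed.

(** [flip] swaps block 0 with block 1 and block 2 with block 3, turning rows into columns; this is
    how J exchanges K and M. *)
Lemma llab_flip p : llab (flip p) = flip (rlab p).
Proof.
have e0 : rev_ord (0 : 'I_2) = 1 by apply: val_inj.
have e1 : rev_ord (1 : 'I_2) = 0 by apply: val_inj.
elim/blkP: p => [s i h|s i j h|s i j hi hj]; rewrite {1}/flip /llab /rlab.
- rewrite (blkW h) blkV /= ?e0 //.
  by elim/ord2P: s h; rewrite /= ?e0 ?e1 //= orbF.
- have := h; rewrite (blkV h); elim/ord2P: s {h} => /=; rewrite ?e0 ?e1 ?orbF /=.
  + by case/andP=> /eqP -> /negPf ->; rewrite eqxx.
  + by move/eqP->; rewrite eqxx.
- by rewrite !blkU //; elim/ord2P: s; rewrite ?e0 ?e1 /= ?e0 ?e1.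
Qed.

Lemma rlab_flip p : rlab (flip p) = flip (llab p).
Proof. by rewrite -{2}(flipK p) llab_flip flipK. Qed.

Lemma blk_llab p q : llab p = llab q -> blk p = blk q.
Proof. by move=> h; rewrite -llab_blk h llab_blk. Qed.

Lemma blk_rlab p q : rlab p = rlab q -> blk p = blk q.
Proof. by move=> h; rewrite -rlab_blk h rlab_blk. Qed.

Lemma llab_inj p q : llab p = llab q -> rlab p = rlab q -> p = q.
Proof.
move=> hl hm; have hb := blk_llab hl; move: hb hl hm.
elim/blkP: p => [s i h|s i j h|s i j hi hj];
  elim/blkP: q => [s' i' h'|s' i' j' h'|s' i' j' hi' hj'];
  rewrite /llab /rlab ?(blkW h) ?(blkW h') ?(blkV h) ?(blkV h') ?blkU //.
by move=> _ [-> ->] [->].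
Qed.

Lemma llab_mix p q : blk p = blk q -> llab (mix p q) = llab p.
Proof.
elim/blkP: p => [s i h|s i j h|s i j hi hj];
  elim/blkP: q => [s' i' h'|s' i' j' h'|s' i' j' hi' hj'];
  rewrite /mix ?(blkW h) ?(blkW h') ?(blkV h) ?(blkV h') ?blkU // => hb;
  rewrite /llab ?(blkW h) ?(blkW h') ?(blkV h) ?(blkV h') //.
by rewrite !blkU //; elim/ord2P: s hb; elim/ord2P: s'.
Qed.

Lemma rlab_mix p q : blk p = blk q -> rlab (mix p q) = rlab q.
Proof.
elim/blkP: p => [s i h|s i j h|s i j hi hj];
  elim/blkP: q => [s' i' h'|s' i' j' h'|s' i' j' hi' hj'];
  rewrite /mix ?(blkW h) ?(blkW h') ?(blkV h) ?(blkV h') ?blkU // => hb;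
  rewrite /rlab ?(blkW h) ?(blkW h') ?(blkV h) ?(blkV h') //.
by rewrite !blkU //; elim/ord2P: s hb; elim/ord2P: s'.
Qed.

Lemma llabW p : blk p = 0%N -> llab p = p.
Proof. by case: p => [[s i] j] h; rewrite /llab h. Qed.

Lemma rlabW p : blk p = 0%N -> rlab p = (0, 0, 0).
Proof. by case: p => [[s i] j] h; rewrite /rlab h. Qed.

(** ** Operators acting through K and through M *)

Section Factors.
Variable R : realType.
Local Notation op := 'M[R[i]]_N.
Implicit Types (T U : op) (p q r : idx).

(** Labels carry the block, so this describes a direct sum over the blocks of operators T_K (x) 1 on
    K (x) M. *)
Definition left_op T := forall r s,
  ent T r s = if rlab r == rlab s then ent T (llab r) (llab s) else 0.

Definition right_op T := forall r s,
  ent T r s = if llab r == llab s then ent T (rlab r) (rlab s) else 0.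

Lemma JconjK : involutive (@Jconj R).
Proof.
by move=> T; apply: ent_inj => p q; rewrite !ent_Jconj !flipK conjcK.
Qed.

Lemma opadjK : involutive (@opadj R).
Proof. by move=> T; apply: ent_inj => p q; rewrite !ent_adj conjcK. Qed.

Lemma opadjM T U : opadj (T * U) = opadj U * opadj T.
Proof.
apply: ent_inj => p q; rewrite ent_adj !entM rmorph_sum; apply: eq_bigr => r _.
by rewrite rmorphM !ent_adj mulrC.
Qed.

Lemma JconjM T U : Jconj (T * U) = Jconj T * Jconj U.
Proof.
apply: ent_inj => p q; rewrite ent_Jconj !entM rmorph_sum.
rewrite [LHS](reindex_inj (can_inj flipK)); apply: eq_bigr => r _.
by rewrite rmorphM; congr (_ * _); apply/esym/ent_Jconj.
Qed.

Lemma Jconj_comm T U V : U = Jconj V -> T * V = V * T ->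
  Jconj T * U = U * Jconj T.
Proof.
move=> -> h; exact: etrans (esym (JconjM _ _)) (etrans (congr1 _ h) (JconjM _ _)).
Qed.

Lemma left_Jconj T : left_op T -> right_op (Jconj T).
Proof.
move=> hT p q; rewrite !ent_Jconj hT !rlab_flip !llab_flip (inj_eq (can_inj flipK)).
by case: ifP; rewrite ?conjc0.
Qed.

Lemma right_Jconj T : right_op T -> left_op (Jconj T).
Proof.
move=> hT p q; rewrite !ent_Jconj hT !rlab_flip !llab_flip (inj_eq (can_inj flipK)).
by case: ifP; rewrite ?conjc0.
Qed.

Lemma left_adj T : left_op T -> left_op (opadj T).
Proof.
by move=> hT p q; rewrite !ent_adj hT eq_sym; case: ifP; rewrite ?conjc0.
Qed.

Lemma right_adj T : right_op T -> right_op (opadj T).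
Proof.
by move=> hT p q; rewrite !ent_adj hT eq_sym; case: ifP; rewrite ?conjc0.
Qed.

(** This collapses the sum over intermediate indices to one term when a left operator is multiplied
    by a right one. *)
Lemma mixP p q r :
  (llab r == llab p) && (rlab r == rlab q) = (blk p == blk q) && (r == mix p q).
Proof.
apply/andP/andP => [[/eqP hl /eqP hm]|[/eqP hb /eqP ->]].
- have hb : blk p = blk q by rewrite -(blk_llab hl) (blk_rlab hm).
  split; apply/eqP => //.
  by apply: llab_inj; rewrite ?llab_mix ?rlab_mix.
- by rewrite llab_mix ?rlab_mix.
Qed.

Lemma sum_mix p q (F : idx -> R[i]) :
  \sum_r (if (llab r == llab p) && (rlab r == rlab q) then F r else 0) =
  if blk p == blk q then F (mix p q) else 0.
Proof.
under eq_bigr => r _ do rewrite mixP.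
case: eqP => /= _; last by rewrite big1.
by rewrite -big_mkcond big_pred1_eq.
Qed.

(** Only the index given by [mix] contributes to an entry of either product, and its contribution is
    [c] both times. *)
Lemma left_right_comm T U : left_op T -> right_op U -> T * U = U * T.
Proof.
move=> hT hU; apply: ent_inj => p q; rewrite !entM.
pose c := ent T (llab p) (llab q) * ent U (rlab p) (rlab q).
transitivity (if blk q == blk p then c else 0).
  rewrite -(sum_mix q p (fun=> c)); apply: eq_bigr => r _.
  rewrite hT hU (eq_sym _ (rlab r)) andbC.
  by case: eqP => [e1|_]; case: eqP => [e2|_]; rewrite ?mulr0 ?mul0r ?e1 ?e2.
rewrite eq_sym -(sum_mix p q (fun=> c)); apply: eq_bigr => r _.
rewrite hT hU (eq_sym _ (llab r)).
by case: eqP => [e1|_]; case: eqP => [e2|_]; rewrite ?mulr0 ?mul0r ?e1 ?e2 // mulrC.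
Qed.

(** The matrix unit of End(K) sending the label q to the label p, tensored
    with the identity of M. *)
Definition left_unit p q : op := op_of (fun r s =>
  ((rlab r == rlab s) && ((llab r == p) && (llab s == q)))%:R).

Lemma left_unitP p q : left_op (left_unit p q).
Proof.
move=> r s; rewrite !ent_op_of !llab_id; case: eqP => //= /blk_rlab h.
by rewrite (rlab_llab h) eqxx.
Qed.

Lemma ent_left_unitM p q T r s : llab q = q ->
  ent (left_unit p q * T) r s =
  if (llab r == p) && (blk q == blk r) then ent T (mix q r) s else 0.
Proof.
move=> hq; rewrite entM; case: (eqVneq (llab r) p) => [hp|/negPf hp] /=.
  rewrite -(sum_mix q r (fun k => ent T k s)); apply: eq_bigr => k _.
  rewrite ent_op_of hp eqxx hq (eq_sym (rlab k)) andbC /=.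
  by case: ifP; rewrite ?mul1r ?mul0r.
by rewrite big1 // => k _; rewrite ent_op_of hp andbF mul0r.
Qed.

Lemma ent_Mleft_unit p q T r s : llab p = p ->
  ent (T * left_unit p q) r s =
  if (llab s == q) && (blk p == blk s) then ent T r (mix p s) else 0.
Proof.
move=> hp; rewrite entM; case: (eqVneq (llab s) q) => [hq|/negPf hq] /=.
  rewrite -(sum_mix p s (fun k => ent T r k)); apply: eq_bigr => k _.
  rewrite ent_op_of hq eqxx hp andbT andbC.
  by case: ifP; rewrite ?mulr1 ?mulr0.
by rewrite big1 // => k _; rewrite ent_op_of hq !andbF mulr0.
Qed.

(** Commuting with the diagonal units makes T diagonal in the K-label; commuting with the units from
    the reference label of a block makes the remaining entries independent of that label. *)
Lemma comm_units_right T :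
  (forall p q, llab p = p -> llab q = q -> rlab p = rlab q ->
     left_unit p q * T = T * left_unit p q) -> right_op T.
Proof.
have mixE p q r : llab p = llab r -> rlab q = rlab r -> mix p q = r.
  move=> hl hm; apply/esym/eqP.
  have := mixP p q r; rewrite hl hm !eqxx /=; by case: (r == _); rewrite ?andbF.
move=> hT r s; case: eqP => [hl|/eqP/negPf hl].
- have hb : blk (rlab r) = blk r by rewrite rlab_blk.
  have := hT (llab r) (llab (rlab r)) (llab_id _) (llab_id _) (rlab_llab (esym hb)).
  move/(congr1 (fun X => ent X r (rlab s))).
  have hb' : blk r = blk s := blk_llab hl.
  rewrite ent_left_unitM ?ent_Mleft_unit ?llab_id // eqxx !llab_blk !rlab_blk hb'.
  rewrite (llab_rlab hb') !eqxx /= => E.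
  have -> : rlab r = mix (llab (rlab s)) r.
    by apply/esym/mixE; rewrite ?llab_id ?rlab_id ?(llab_rlab hb').
  by rewrite E; congr (ent T r _); apply/esym/mixE; rewrite ?llab_id ?rlab_id.
- have := hT (llab s) (llab s) (llab_id _) (llab_id _) erefl.
  move/(congr1 (fun X => ent X r s)).
  rewrite ent_left_unitM ?ent_Mleft_unit ?llab_id // hl llab_blk !eqxx /= => E.
  by rewrite E; congr (ent T r _); apply/esym/mixE; rewrite ?llab_id.
Qed.

(** Conjugation by J reduces this to [comm_units_right], as it turns the left units into right
    operators. *)
Lemma comm_right_left T :
  (forall U, right_op U -> T * U = U * T) -> left_op T.
Proof.
move=> hT; rewrite -(JconjK T); apply: right_Jconj.
apply: comm_units_right => p q _ _ _.
apply/esym/(Jconj_comm (esym (JconjK _)))/hT.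
exact/left_Jconj/left_unitP.
Qed.

(** The fixed points of [llab] index the bases of the spaces K, and two of them have equal [rlab]
    exactly when they lie in one block. *)
Lemma left_op_span T : left_op T ->
  T = \sum_(x : idx * idx | [&& llab x.1 == x.1, llab x.2 == x.2
                               & rlab x.1 == rlab x.2])
        ent T x.1 x.2 *: left_unit x.1 x.2.
Proof.
move=> hT; apply: ent_inj => r s; rewrite ent_sum hT.
case: (boolP (rlab r == rlab s)) => [/eqP hm|/negPf hm]; last first.
  by rewrite big1 // => x _; rewrite entZ ent_op_of hm mulr0.
rewrite (bigD1 (llab r, llab s)) /=; last first.
  by rewrite !llab_id !eqxx /= (rlab_llab (blk_rlab hm)).
rewrite entZ ent_op_of hm !eqxx mulr1 big1 ?addr0 // => [[p q]] /= /andP[_ hx].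
rewrite entZ ent_op_of hm eqxx /=; move: hx; rewrite xpair_eqE.
by rewrite (eq_sym p) (eq_sym q) => /negPf ->; rewrite mulr0.
Qed.

End Factors.

(** ** Elementary tensors and the algebra A *)

Section Tensors.
Variable R : realType.
Local Notation op := 'M[R[i]]_N.
Implicit Types (T U : op) (p q r : idx).
Implicit Types (x : 'M[R[i]]_4) (m : 'M[R[i]]_2) (y : 'M[R[i]]_4).

(** Unification otherwise unfolds [tens] down to its 32 x 32 coordinates. *)
Definition ltens x m y : op := locked (@tens R) x m y.

Lemma ltensE x m y : tens x m y = ltens x m y.
Proof. by rewrite /ltens -lock. Qed.

Lemma ent_ltens x m y s i j s' i' j' :
  ent (ltens x m y) (s, i, j) (s', i', j') = x i i' * m s s' * y j j'.
Proof. by rewrite -ltensE ent_tens. Qed.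

Lemma ltensDl x x' m y : ltens (x + x') m y = ltens x m y + ltens x' m y.
Proof.
apply: ent_inj => -[[s i] j] [[s' i'] j'].
by rewrite entD !ent_ltens mxE !mulrDl.
Qed.

Lemma ltensDm x m m' y : ltens x (m + m') y = ltens x m y + ltens x m' y.
Proof.
apply: ent_inj => -[[s i] j] [[s' i'] j'].
by rewrite entD !ent_ltens mxE mulrDr mulrDl.
Qed.

Lemma ltensDr x m y y' : ltens x m (y + y') = ltens x m y + ltens x m y'.
Proof.
apply: ent_inj => -[[s i] j] [[s' i'] j'].
by rewrite entD !ent_ltens mxE mulrDr.
Qed.

Lemma ltensZl c x m y : ltens (c *: x) m y = c *: ltens x m y.
Proof.
apply: ent_inj => -[[s i] j] [[s' i'] j'].
by rewrite entZ !ent_ltens mxE !mulrA.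
Qed.

Lemma ltensZm c x m y : ltens x (c *: m) y = c *: ltens x m y.
Proof.
apply: ent_inj => -[[s i] j] [[s' i'] j'].
by rewrite entZ !ent_ltens mxE mulrCA !mulrA.
Qed.

Lemma ltensZr c x m y : ltens x m (c *: y) = c *: ltens x m y.
Proof.
apply: ent_inj => -[[s i] j] [[s' i'] j'].
by rewrite entZ !ent_ltens mxE mulrCA.
Qed.

Lemma ltensM x m y x' m' y' :
  ltens x m y * ltens x' m' y' = ltens (x *m x') (m *m m') (y *m y').
Proof.
apply: ent_inj => -[[s i] j] [[s' i'] j']; rewrite entM ent_ltens !mxE.
rewrite big_distrlr /= pair_bigA big_distrl /=.
rewrite (reindex (fun u : 'I_2 * 'I_4 => (u.2, u.1))) /=; last first.
  by exists (fun u => (u.2, u.1)) => [] [].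
rewrite [RHS](eq_bigr (fun u => \sum_k ent (ltens x m y) (s, i, j) (u.1, u.2, k)
   * ent (ltens x' m' y') (u.1, u.2, k) (s', i', j'))).
  by rewrite pair_bigA; apply: eq_bigr => -[[? ?] ?] _.
case=> a b _; rewrite big_distrr; apply: eq_bigr => k _ /=.
by rewrite !ent_ltens (mulrACA (x i b)) [LHS]mulrACA.
Qed.

Lemma ltens_adj x m y : opadj (ltens x m y) = ltens (mdag x) (mdag m) (mdag y).
Proof.
apply: ent_inj => -[[s i] j] [[s' i'] j'].
by rewrite ent_adj !ent_ltens !rmorphM !mxE.
Qed.

Lemma mdag_eu n (i j : 'I_n) : mdag (eu i j) = eu j i :> 'M[R[i]]_n.
Proof.
apply/matrixP => a b; rewrite !mxE (rmorph_nat (@conjc R)).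
by rewrite andbC.
Qed.

(** Left factors are indexed by pairs (summand, row). *)
Definition tunit (a b : 'I_2 * 'I_4) y : op := ltens (eu a.2 b.2) (eu a.1 b.1) y.

Lemma eu_mul_eu n (i j k l : 'I_n) (x : 'M[R[i]]_n) :
  eu i j *m x *m eu k l = x j k *: eu i l.
Proof.
apply/matrixP => a b; rewrite !mxE (bigD1 k) //= big1 ?addr0; last first.
  by move=> c /negPf hc; rewrite !mxE hc mulr0.
rewrite !mxE (bigD1 j) //= big1 ?addr0; last first.
  by move=> c /negPf hc; rewrite !mxE hc andbF mul0r.
by rewrite !mxE !eqxx andbT mulrAC -natrM mulnb mulrC.
Qed.

Lemma tunitM a b c y y' : tunit a b y * tunit b c y' = tunit a c (y *m y').
Proof. by rewrite /tunit ltensM !mul_delta_mx. Qed.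

Lemma tunit_tens_tunit a b c d x m y y' z :
  tunit a b y * ltens x m z * tunit c d y' =
  (x b.2 c.2 * m b.1 c.1) *: tunit a d (y *m z *m y').
Proof.
by rewrite /tunit !ltensM !eu_mul_eu ltensZl ltensZm scalerA.
Qed.

Lemma tunit_adj a b y : opadj (tunit a b y) = tunit b a (mdag y).
Proof. by rewrite /tunit ltens_adj !mdag_eu. Qed.

Lemma left_opD T U : left_op T -> left_op U -> left_op (T + U).
Proof.
move=> hT hU p q; rewrite !entD hT hU.
by case: ifP => _; rewrite ?addr0.
Qed.

(** On block 0 the factor M is a line, so every operator supported there acts through K. *)
Lemma left_opW T :
  (forall p q, (blk p != 0%N) || (blk q != 0%N) -> ent T p q = 0) -> left_op T.
Proof.
move=> hT r s; case: (boolP ((blk r != 0%N) || (blk s != 0%N))) => h.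
  by rewrite !hT ?llab_blk //; case: ifP.
move: h; rewrite negb_or !negbK => /andP[/eqP hr /eqP hs].
by rewrite !rlabW // eqxx !llabW.
Qed.

(** A acts on rows only, and on block 1 by the scalar lambda, because both first rows carry the same
    lambda. *)
Lemma inA_left T : inA T -> left_op T.
Proof.
case=> lam [z [w [m ->]]] [[s i] j] [[s' i'] j'].
rewrite entD !ltensE !ent_ltens /llab /rlab /blk.
elim/ord2P: s; elim/ord2P: s'; elim/ord4P: i; elim/ord4P: i' => /=.
all: have [->|hj] := eqVneq j 0; have [->|hj'] := eqVneq j' 0.
all: rewrite /= ?xpair_eqE /= ?entD ?ent_ltens !mxE /=.
all: rewrite ?mulr0 ?mul0r ?mulr1 ?addr0 ?add0r ?if_same //=.
all: try by rewrite ?eqxx ?(negPf hj) ?(negPf hj') ?(eq_sym 0) ?(negPf hj')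
  ?mulr0 ?mulr1.
all: by case: eqP; rewrite ?mulr0 ?mulr1.
Qed.

(** With the first M-index, [(1, 0, 0)] is the only basis vector outside block 0; the hypotheses
    clear its row and column. For the terms in Y this uses delta_21 = 0. *)
Lemma left_ltensW x m :
  (forall i s, x 0 i * m 1 s = 0) -> (forall i s, x i 0 * m s 1 = 0) ->
  left_op (ltens x m (eu 0 0)).
Proof.
move=> h1 h2; apply: left_opW => -[[s i] j] [[s' i'] j'].
rewrite ent_ltens mxE; have [->|_] := eqVneq j 0; last by rewrite mulr0.
have [->|_] := eqVneq j' 0; last by rewrite mulr0.
have blk0 a b : blk (a, b, 0) != 0%N -> (a = 1) /\ (b = 0).
  by elim/ord2P: a => /=; have [->|_] := eqVneq b 0.
by case/orP=> /blk0[-> ->]; rewrite ?h1 ?h2 mul0r.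
Qed.

(** Clearing the first row and column confines the operator to block 2; for the beta term this is
    beta_13 = beta_14 = 0. *)
Lemma left_ltensU x : (forall i, x 0 i = 0) -> (forall i, x i 0 = 0) ->
  left_op (ltens x (eu 0 0) (1%:M - eu 0 0)).
Proof.
move=> h1 h2 [[s i] j] [[s' i'] j']; rewrite ent_ltens /llab /rlab /blk.
elim/ord2P: s; elim/ord2P: s' => /=; have [->|hi] := eqVneq i 0;
  have [->|hi'] := eqVneq i' 0; have [->|hj] := eqVneq j 0;
  have [->|hj'] := eqVneq j' 0.
all: rewrite /= ?xpair_eqE /= ?ent_ltens ?h1 ?h2 !mxE /=.
all: rewrite ?mulr0 ?mul0r ?subr0 ?subrr ?mulr1 ?if_same //=.
all: rewrite ?eqxx ?(negPf hj) ?(negPf hj') ?(negPf hi) ?(negPf hi') ?(eq_sym 0).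
all: rewrite ?(negPf hj) ?(negPf hj') ?mulr0 ?mulr1 ?subr0 ?subrr ?mulr0 //=.
by case: eqP; rewrite ?mulr0 ?mulr1.
Qed.

Lemma eu00_mul x (c : R[i]) : (forall b, x 0 b = c *+ (b == 0)) ->
  eu 0 0 *m x = c *: eu 0 0.
Proof.
move=> h; apply/matrixP => a b; rewrite !mxE (bigD1 0) //= big1 ?addr0.
  rewrite mxE h andbT; case: (a == 0); case: (b == 0);
    by rewrite ?(mulr0, mul0r) // mulrC.
by move=> k /negPf hk; rewrite !mxE hk andbF mul0r.
Qed.

Lemma mul_eu00 x (c : R[i]) : (forall a, x a 0 = c *+ (a == 0)) ->
  x *m eu 0 0 = c *: eu 0 0.
Proof.
move=> h; apply/matrixP => a b; rewrite !mxE (bigD1 0) //= big1 ?addr0.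
  by rewrite mxE h; case: (a == 0); case: (b == 0); rewrite /= ?(mulr0, mul0r).
by move=> k /negPf hk; rewrite !mxE hk mulr0.
Qed.

(** The complex span of A: as A is a real algebra, two terms already give all of A + iA. *)
Definition inAC T := exists (c c' : R[i]) (a a' : op),
  [/\ inA a, inA a' & T = c *: a + c' *: a'].

Lemma inACI x y c l z w (m : 'M_3) c' l' z' w' (m' : 'M_3) :
  x = c *: diag1 l z w + c' *: diag1 l' z' w' ->
  y = c *: diag2 l m + c' *: diag2 l' m' ->
  inAC (ltens x (eu 0 0) 1%:M + ltens y (eu 1 1) 1%:M).
Proof.
move=> -> ->; exists c, c',
  (tens (diag1 l z w) (eu 0 0) 1%:M + tens (diag2 l m) (eu 1 1) 1%:M),
  (tens (diag1 l' z' w') (eu 0 0) 1%:M + tens (diag2 l' m') (eu 1 1) 1%:M).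
split; [by exists l, z, w, m|by exists l', z', w', m'|].
by rewrite !ltensE !ltensDl !ltensZl !scalerDr addrACA.
Qed.

Lemma ltens0l m y : ltens 0 m y = 0 :> op.
Proof. by rewrite -(scale0r 0) ltensZl scale0r. Qed.

Let h : R[i] := 2^-1.
Let hh : h + h = 1.
Proof. by rewrite -mulr2n -(mulr_natr h) mulVf // Num.Theory.pnatr_eq0. Qed.
Let I : R[i] := 'i.
Let conjI : conjc I = - I.
Proof. by apply/eqP; rewrite eq_complex /= oppr0 !eqxx. Qed.
Let conjI' : Num.conj I = - I. Proof. exact: conjI. Qed.
Let hII : - (h * I) * I = h.
Proof. by rewrite mulNr -mulrA -expr2 sqr_i mulrN1 opprK. Qed.
Let hII' : h * I * I = - h.
Proof. by rewrite -[in RHS]hII mulNr opprK. Qed.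

Ltac diag_unit := apply/matrixP; elim/ord4P; elim/ord4P;
  rewrite /diag1 ?(conjI, conjI', conjc1, conjc0)
    ?(Num.Theory.conjC1, Num.Theory.conjC0) !mxE /=
    ?(mulr0, mul0r, mulr1, mulrN1, mulrN, hII, hII', opprK, oppr0)
    ?(addr0, add0r, hh, subrr, addNr, opprK, oppr0).

(** Half of the element with lambda = 1 minus i/2 times the one with lambda = i keeps lambda and
    cancels its conjugate. The rows u_1 and d_1 stay together because they share lambda. *)
Lemma inAC_P : inAC (tunit (0, 0) (0, 0) 1%:M + tunit (1, 0) (1, 0) 1%:M).
Proof.
by apply: (@inACI _ _ h 1 0 0 0 (- (h * I)) I 0 0 0); diag_unit.
Qed.

(** The opposite sign keeps the conjugate of lambda, which occurs only at u_2. *)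
Lemma inAC_u1 : inAC (tunit (0, 1) (0, 1) 1%:M).
Proof.
rewrite -[tunit _ _ _]addr0 -(ltens0l (eu 1 1) 1%:M).
by apply: (@inACI _ _ h 1 0 0 0 (h * I) I 0 0 0); diag_unit.
Qed.

(** The quaternions span M_2(C) over the complex numbers; the same device separates z and w from
    their conjugates. *)
Lemma inAC_u (j k : 'I_4) : (1 < j)%N -> (1 < k)%N ->
  inAC (tunit (0, j) (0, k) 1%:M).
Proof.
rewrite -[tunit _ _ _]addr0 -(ltens0l (eu 1 1) 1%:M).
elim/ord4P: j => // _; elim/ord4P: k => // _.
- by apply: (@inACI _ _ h 0 1 0 0 (- (h * I)) 0 I 0 0); diag_unit.
- by apply: (@inACI _ _ h 0 0 1 0 (- (h * I)) 0 0 I 0); diag_unit.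
- by apply: (@inACI _ _ (- h) 0 0 1 0 (- (h * I)) 0 0 I 0); diag_unit.
- by apply: (@inACI _ _ h 0 1 0 0 (h * I) 0 I 0 0); diag_unit.
Qed.

Lemma inAC_d (j k : 'I_4) : (0 < j)%N -> (0 < k)%N ->
  inAC (tunit (1, j) (1, k) 1%:M).
Proof.
rewrite -[tunit _ _ _]add0r -(ltens0l (eu 0 0) 1%:M) => hj hk.
(* The M_3 summand occupies rows 1 to 3, hence the shift of the indices by one. *)
pose m : 'M[R[i]]_3 :=
  \matrix_(a, b) ((a == j.-1 :> nat) && (b == k.-1 :> nat))%:R.
apply: (@inACI _ _ 1 0 0 0 m 0 0 0 0 0); first by diag_unit.
by elim/ord4P: j hj @m => // _; elim/ord4P: k hk => // _ m;
  apply/matrixP; elim/ord4P; elim/ord4P;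
  rewrite !mxE /= ?inordK //= ?mulr0 ?mul0r ?mulr1 ?addr0.
Qed.

End Tensors.

(** ** The Clifford algebra *)

Section DiracOperator.
Variable R : realType.
Local Notation op := 'M[R[i]]_N.
Implicit Types (T U : op) (p q r : idx).
Implicit Types (x : 'M[R[i]]_4) (m : 'M[R[i]]_2) (y : 'M[R[i]]_4).
Variables a13 a14 a23 a24 b23 b24 d12 d13 d14 d22 d23 d24 ups : R[i].

Notation Xa := (Xmat a13 a14 a23 a24).
Notation Xb := (Xmat 0 0 b23 b24).
Notation Y := (Ymat d12 d13 d14 0 d22 d23 d24).
Notation rest := (1%:M - eu 0 0 : 'M[R[i]]_4).

Definition D0red : op :=
  ltens Xa (eu 0 0) (eu 0 0) + ltens Xb (eu 0 0) rest
  + ltens Y (eu 0 1) (eu 0 0) + ltens (mdag Y) (eu 1 0) (eu 0 0).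

Definition Dred : op := D0red + Jconj D0red + DR ups.

Lemma Dirac_Dred :
  Dirac a13 a14 a23 a24 0 0 b23 b24 d12 d13 d14 0 d22 d23 d24 ups = Dred.
Proof. by rewrite /Dred /D0red -!ltensE. Qed.

Lemma D0red_left : left_op D0red.
Proof.
apply: left_opD; [apply: left_opD; [apply: left_opD|]|].
- by apply: left_ltensW => i s; rewrite !mxE /= ?andbF ?mulr0.
- by apply: left_ltensU; elim/ord4P; rewrite !mxE /= ?oppr0.
- by apply: left_ltensW; elim/ord4P => s; rewrite !mxE /= ?andbF ?mulr0 ?mul0r.
- by apply: left_ltensW; elim/ord4P => s; rewrite !mxE /= ?andbF ?oppr0 ?mulr0 ?mul0r.
Qed.

(** D_R only mixes u_1 r_1 with d_1 r_1, and A acts on both by the same lambda. *)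
Lemma DR_comm T : inA T -> DR ups * T = T * DR ups.
Proof.
case=> lam [z [w [m ->]]]; rewrite /DR !ltensE.
set n := (_ + _ : 'M_2).
have e01 : eu 0 0 + eu 1 1 = 1%:M :> 'M[R[i]]_2.
  by apply/matrixP; elim/ord2P; elim/ord2P; rewrite !mxE /= ?addr0 ?add0r.
have d1 : forall b, diag1 lam z w 0 b = lam *+ (b == 0).
  by elim/ord4P; rewrite !mxE.
have d1' : forall b, diag1 lam z w b 0 = lam *+ (b == 0).
  by elim/ord4P; rewrite !mxE.
have d2 : forall b, diag2 lam m 0 b = lam *+ (b == 0).
  by elim/ord4P; rewrite !mxE.
have d2' : forall b, diag2 lam m b 0 = lam *+ (b == 0).
  by elim/ord4P; rewrite !mxE.
rewrite mulrDr mulrDl !ltensM !mulmx1 !mul1mx.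
rewrite (eu00_mul d1) (eu00_mul d2) (mul_eu00 d1') (mul_eu00 d2') !ltensZl.
by rewrite -!scalerDr -!ltensDm -mulmxDr -mulmxDl e01 mulmx1 mul1mx.
Qed.

Lemma comm_Dred_inA b : inA b -> Dred * b - b * Dred = D0red * b - b * D0red.
Proof.
have E (V : zmodType) (u u' v w : V) : u + v + w - (u' + v + w) = u - u'.
  by rewrite opprD addrACA subrr addr0 opprD addrACA subrr addr0.
move=> hb; rewrite /Dred !mulrDl !mulrDr (DR_comm hb).
rewrite (left_right_comm (inA_left hb) (left_Jconj D0red_left)).
exact: E.
Qed.

(** D_1 acts through the M's and D_R commutes with A, so only A and D_0 matter. *)
Lemma ClD_ind (P : op -> Prop) :
  (forall T U, P T -> P U -> P (T + U)) -> (forall c T, P T -> P (c *: T)) ->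
  (forall T U, P T -> P U -> P (T * U)) -> (forall T, P T -> P (opadj T)) ->
  (forall a, inA a -> P a) -> P D0red -> forall T, ClD Dred T -> P T.
Proof.
move=> hD hZ hM hadj hA hD0 T; elim=> {T} [T [hT|[a [b [ha [hb ->]]]]]| | | |];
  do ?by move=> *; auto.
rewrite comm_Dred_inA //; apply: (hM); first exact: hA.
apply: (hD); first by apply: (hM) => //; exact: hA.
by rewrite -scaleN1r; apply: hZ; apply: (hM) => //; exact: hA.
Qed.

(** Commuting with all right operators characterises left operators and passes to products and
    adjoints without any index computation. *)
Lemma ClD_left T : ClD Dred T -> left_op T.
Proof.
move=> hT; apply: comm_right_left; move: T hT.
apply: ClD_ind.
- by move=> T U hT hU V hV; rewrite mulrDl mulrDr hT // hU.
- by move=> c T hT V hV; rewrite -scalerAl hT // scalerAr.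
- by move=> T U hT hU V hV; rewrite -mulrA hU // !mulrA hT.
- move=> T hT V hV; apply: (can_inj (@opadjK R)).
  by rewrite (opadjM _ V) (opadjM V) opadjK hT //; exact: right_adj.
- by move=> a ha V hV; apply: left_right_comm hV; exact: inA_left.
- by move=> V; apply: left_right_comm; exact: D0red_left.
Qed.

(** The commutant of the left operators consists of the right ones, and these are the J-conjugates
    of the left ones. *)
Lemma left_ClD_Hodge : (forall T, left_op T -> ClD Dred T) -> Hodge Dred.
Proof.
move=> hcl T; split=> [hT|[U [hU ->]] V hV].
- exists (opadj (Jconj T)); split; last by rewrite /opp_op opadjK JconjK.
  apply/hcl/left_adj/right_Jconj/comm_units_right => p q _ _ _.
  by apply/esym/hT/hcl; exact: left_unitP.
- apply/esym/left_right_comm; first exact: ClD_left.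
  by apply/left_Jconj/left_adj/ClD_left.
Qed.

(** * Necessity: projections from colourings of the graph *)

Section Colouring.
Variables f1 f2 f3 : bool -> bool.

(** [f1], [f2], [f3] colour u_2, {u_3, u_4}, {d_2, d_3, d_4}; the boolean argument
    tells whether the M-index is the first one.  u_1 and d_1 have colour [false]. *)
Definition colour (p : idx) : bool :=
  let: (s, i, j) := p in
  if i == 0 then false
  else (if s == 0 then (if i == 1 then f1 else f2) else f3) (j == 0).

Definition coloured T := forall p q, colour p != colour q -> ent T p q = 0.

Definition colour_proj : op :=
  op_of (fun p q => ((p == q) && colour p)%:R).

Lemma coloured_comm T : coloured T -> T * colour_proj = colour_proj * T.
Proof.
move=> hT; apply: ent_inj => p q; rewrite !entM (bigD1 q) //= big1 ?addr0.
  rewrite [RHS](bigD1 p) //= big1 ?addr0.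
    rewrite !ent_op_of !eqxx /=; case: (eqVneq (colour p) (colour q)) => [->|h].
      by rewrite mulrC.
    by rewrite hT // mul0r mulr0.
  by move=> r /negPf h; rewrite ent_op_of eq_sym h mul0r.
by move=> r /negPf h; rewrite ent_op_of h mulr0.
Qed.

Lemma colouredD T U : coloured T -> coloured U -> coloured (T + U).
Proof. by move=> hT hU p q h; rewrite entD hT ?hU ?addr0. Qed.

Lemma inA_coloured T : inA T -> coloured T.
Proof.
case=> lam [z [w [m ->]]] [[s i] j] [[s' i'] j'].
rewrite entD !ltensE !ent_ltens [_%:M _ _]mxE.
have [->|_] := eqVneq j j'; last by rewrite !mulr0 addr0.
elim/ord2P: s; elim/ord2P: s'; elim/ord4P: i; elim/ord4P: i'; rewrite /= ?eqxx //.
all: by rewrite !mxE /= ?(mulr0, mul0r, addr0).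
Qed.

(** Read contrapositively, each non-zero edge joins vertices of one colour. The edges alpha_1 and
    delta_1 start at u_1, whose colour is [false]; beta is felt only at the M-indices other than the
    first. *)
Hypothesis fa1 : f2 true -> (a13, a14) = (0, 0).
Hypothesis fa2 : f1 true != f2 true -> (a23, a24) = (0, 0).
Hypothesis fd1 : f3 true -> (d12, d13, d14) = (0, 0, 0).
Hypothesis fd2 : f1 true != f3 true -> (d22, d23, d24) = (0, 0, 0).
Hypothesis fb : f1 false != f2 false -> (b23, b24) = (0, 0).

Lemma D0red_coloured : coloured D0red.
Proof.
have col_ltens x m :
    (forall s i s' i', colour (s, i, 0) != colour (s', i', 0) ->
       x i i' * m s s' = 0) -> coloured (ltens x m (eu 0 0)).
  move=> h [[s i] j] [[s' i'] j']; rewrite ent_ltens mxE.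
  have [->|_] := eqVneq j 0; last by rewrite mulr0.
  have [->|_] := eqVneq j' 0; last by rewrite mulr0.
  by move/h->; rewrite mul0r.
apply: colouredD; [apply: colouredD; [apply: colouredD|]|].
- apply: col_ltens => s i s' i'; rewrite !mxE.
  elim/ord2P: s; rewrite ?mulr0 //; elim/ord2P: s'; rewrite ?mulr0 //.
  elim/ord4P: i; elim/ord4P: i' => /=; move: fa1 fa2;
  case: (f1 true); case: (f2 true) => //= h1 h2 _;
  first [by case: (h1 isT) => e e'; rewrite ?e ?e' /= ?oppr0 mul0r
        |by case: (h2 isT) => e e'; rewrite ?e ?e' /= ?oppr0 mul0r].
- move=> [[s i] j] [[s' i'] j']; rewrite ent_ltens !mxE.
  elim/ord2P: s; rewrite ?mulr0 ?mul0r //; elim/ord2P: s'; rewrite ?mulr0 ?mul0r //.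
  have [->|hj] := eqVneq j j'; last first.
    rewrite (_ : (j == 0) && (j' == 0) = false) ?subr0 ?mulr0 //.
    by apply/negP => /andP[/eqP h /eqP h']; rewrite h h' eqxx in hj.
  have [->|hj'] := eqVneq j' 0; first by rewrite subrr mulr0.
  elim/ord4P: i; elim/ord4P: i' => /=;
  rewrite ?(negPf hj') ?eqxx ?mul0r ?oppr0 ?mul0r //;
  move: fb; case: (f1 false); case: (f2 false) => //= h _;
  by case: (h isT) => e e'; rewrite ?e ?e' /= ?oppr0 !mul0r.
- apply: col_ltens => s i s' i'; rewrite !mxE.
  elim/ord2P: s; rewrite ?mulr0 //; elim/ord2P: s'; rewrite ?mulr0 ?andbF ?mulr0 //.
  elim/ord4P: i; elim/ord4P: i' => /=; rewrite ?mul0r //; move: fd1 fd2;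
  case: (f1 true); case: (f3 true) => //= h1 h2 _;
  first [by case: (h1 isT) => e e' e''; rewrite ?e ?e' ?e'' /= ?oppr0 mul0r
        |by case: (h2 isT) => e e' e''; rewrite ?e ?e' ?e'' /= ?oppr0 mul0r].
- apply: col_ltens => s i s' i'; rewrite !mxE.
  elim/ord2P: s; rewrite ?mulr0 //; elim/ord2P: s'; rewrite ?mulr0 ?andbF ?mulr0 //.
  elim/ord4P: i; elim/ord4P: i' => /=; rewrite ?oppr0 ?mul0r //; move: fd1 fd2;
  case: (f1 true); case: (f3 true) => //= h1 h2 _;
  first [by case: (h1 isT) => e e' e''; rewrite ?e ?e' ?e'' /= ?oppr0 mul0r
        |by case: (h2 isT) => e e' e''; rewrite ?e ?e' ?e'' /= ?oppr0 mul0r].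
Qed.

(** The projection commutes with the Clifford algebra, so the Hodge property makes it a right
    operator, whose diagonal depends on the M-label alone. *)
Lemma Hodge_colour : Hodge Dred ->
  [/\ f1 true = false, f2 true = false, f3 true = false
    & f1 false = f2 false].
Proof.
move=> hH; have hP : commutant (ClD Dred) colour_proj.
  move=> T hT; apply/esym/coloured_comm; move: T hT; apply: ClD_ind.
  - exact: colouredD.
  - by move=> c T hT p q h; rewrite entZ hT // mulr0.
  - move=> T U hT hU p q h; rewrite entM big1 // => r _.
    case: (eqVneq (colour p) (colour r)) => [e|e]; last by rewrite hT // mul0r.
    by rewrite hU ?mulr0 // -e.
  - by move=> T hT p q h; rewrite ent_adj hT ?conjc0 // eq_sym.
  - exact: inA_coloured.
  - exact: D0red_coloured.
case/hH: hP => U [hU eU].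
have /left_Jconj : left_op (opadj U) by apply/left_adj/ClD_left.
rewrite -/(opp_op U) -eU => hR.
have hcol p : colour p = colour (rlab p).
  have := hR p p; rewrite !ent_op_of !eqxx /=.
  by case: (colour p); case: (colour _) => //= /eqP;
    rewrite ?oner_eq0 // eq_sym oner_eq0.
(* In block 0 every M-label is [(0, 0, 0)], of colour [false]; in block 2 the vector u_3 is compared
   with u_2. *)
split.
- exact: hcol (0, 1, 0).
- exact: hcol (0, Ordinal (isT : 2 < 4)%N, 0).
- exact: hcol (1, 1, 0).
- exact: esym (hcol (0, Ordinal (isT : 2 < 4)%N, 1)).
Qed.

End Colouring.

Lemma Hodge_graph : Hodge Dred ->
   ((b23, b24) != (0, 0)) /\
   leq 3 (nat_of_bool ((a13, a14) != (0%R, 0%R))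
           + nat_of_bool ((a23, a24) != (0%R, 0%R))
           + nat_of_bool ((d12, d13, d14) != (0%R, 0%R, 0%R))
           + nat_of_bool ((d22, d23, d24) != (0%R, 0%R, 0%R)))%N.
Proof.
move=> hH; split.
  apply/negP => /eqP hb.
  (* [negb] gives u_2 the colour [true] exactly at the M-indices other than the first, where only
     beta could join it to u_3 and u_4. *)
  by case: (@Hodge_colour negb xpred0 xpred0 _ _ _ _ _ hH).
(* These colourings are [false] away from the first M-index, so they put no condition on beta. *)
have hk (c1 c2 c3 : bool) :
  (c2 -> (a13, a14) = (0, 0)) -> (c1 != c2 -> (a23, a24) = (0, 0)) ->
  (c3 -> (d12, d13, d14) = (0, 0, 0)) ->
  (c1 != c3 -> (d22, d23, d24) = (0, 0, 0)) -> [|| c1, c2 | c3] -> False.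
  move=> h1 h2 h3 h4; have h5 : andb^~ c1 false != andb^~ c2 false ->
    (b23, b24) = (0, 0) by [].
  by case: (@Hodge_colour (andb^~ c1) (andb^~ c2) (andb^~ c3) h1 h2 h3 h4 h5 hH)
    => /= -> -> ->.
have [e1|_] := eqVneq (a13, a14) (0, 0); have [e2|_] := eqVneq (a23, a24) (0, 0);
  have [e3|_] := eqVneq (d12, d13, d14) (0, 0, 0);
  have [e4|_] := eqVneq (d22, d23, d24) (0, 0, 0) => //; exfalso;
  (* With two edges of the 4-cycle missing, some set of vertices avoiding u_1 is cut off and can be
     coloured [true]. *)
  first [ by apply: (hk true false false) | by apply: (hk false true false)
        | by apply: (hk false false true) | by apply: (hk true true false)
        | by apply: (hk true false true) | by apply: (hk true true true)].
Qed.

(** * Corners of D_0 inside the Clifford algebra *)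

Notation Cl := (ClD Dred).
Notation e1 := (eu 0 0 : 'M[R[i]]_4).

Lemma ClDB T U : Cl T -> Cl U -> Cl (T - U).
Proof.
by move=> hT hU; rewrite -scaleN1r; apply: gen_add => //; apply: gen_scale.
Qed.

Lemma ClD_unscale (c : R[i]) T : c != 0 -> Cl (c *: T) -> Cl T.
Proof. by move=> hc /(gen_scale c^-1); rewrite scalerA mulVf // scale1r. Qed.

Lemma inAC_ClD b : inAC b -> Cl b.
Proof.
by case=> c [c' [a [a' [ha ha' ->]]]]; apply: gen_add; apply/gen_scale/gen_base; left.
Qed.

Lemma comm_linear (X u u' : op) (z z' : R[i]) :
  X * (z *: u + z' *: u') - (z *: u + z' *: u') * X =
  z *: (X * u - u * X) + z' *: (X * u' - u' * X).
Proof.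
by rewrite mulrDr mulrDl -!scalerAr -!scalerAl opprD addrACA -!scalerBr.
Qed.

(** Since b c = 0, the product b [D_0, c] equals b D_0 c; bilinearity carries this from A to its
    complex span. *)
Lemma ClD_off_diagonal b c : inAC b -> inAC c -> b * c = 0 -> Cl (b * D0red * c).
Proof.
move=> hb hc hbc.
suff : Cl (b * (D0red * c - c * D0red)) by rewrite mulrBr !mulrA hbc mul0r subr0.
have K a a' : inA a -> inA a' -> Cl (a * (D0red * a' - a' * D0red)).
  by move=> ha ha'; rewrite -(comm_Dred_inA ha');
    apply: gen_base; right; exists a, a'.
have {}K a : inA a -> Cl (a * (D0red * c - c * D0red)).
  case: hc => z [z' [u [u' [hu hu' ->]]]] ha.
  have -> : D0red * (z *: u + z' *: u') - (z *: u + z' *: u') * D0red =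
      z *: (D0red * u - u * D0red) + z' *: (D0red * u' - u' * D0red).
    exact: comm_linear.
  by rewrite mulrDr -!scalerAr; apply: gen_add; apply/gen_scale/K.
case: hb => z [z' [u [u' [hu hu' ->]]]].
by rewrite mulrDl -!scalerAl; apply: gen_add; apply/gen_scale/K.
Qed.

Lemma tunit_D0red a b c d :
  tunit a b 1%:M * D0red * tunit c d 1%:M =
  (Xa b.2 c.2 * eu 0 0 b.1 c.1 + Y b.2 c.2 * eu 0 1 b.1 c.1
    + mdag Y b.2 c.2 * eu 1 0 b.1 c.1) *: tunit a d e1
  + (Xb b.2 c.2 * eu 0 0 b.1 c.1) *: tunit a d rest.
Proof.
have E (V : zmodType) (u v w t : V) : u + v + w + t = u + w + t + v.
  by rewrite (addrAC u) (addrAC (u + w)).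
rewrite /D0red !mulrDr !mulrDl !tunit_tens_tunit !mulmx1 !mul1mx !scalerDl.
exact: E.
Qed.

(** * Links between vertices of the graph *)

(** [linked] concerns the part of the algebra acting on M-index 1,
    [linked_rest] the part acting on the other M-indices. *)
Definition linked (a b : 'I_2 * 'I_4) := Cl (tunit a b e1).

Lemma mdag_e1 : mdag e1 = e1. Proof. exact: mdag_eu. Qed.

Lemma e1M : e1 *m e1 = e1. Proof. by rewrite mul_delta_mx. Qed.

Lemma linked_sym a b : linked a b -> linked b a.
Proof. by move/gen_adj; rewrite tunit_adj mdag_e1. Qed.

Lemma linked_trans b a c : linked a b -> linked b c -> linked a c.
Proof. by move=> h1 h2; have := gen_mul h1 h2; rewrite tunitM e1M. Qed.

Lemma linked_refl a b : linked a b -> linked b b.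
Proof. by move=> h; exact: linked_trans (linked_sym h) h. Qed.

Lemma tunit_orth a b c d y y' : b != c -> tunit a b y * tunit c d y' = 0.
Proof.
have ltens0m x y0 : ltens x 0 y0 = 0 :> op by rewrite -(scale0r 0) ltensZm scale0r.
case: b c => [s i] [s' i']; rewrite xpair_eqE negb_and /tunit ltensM /=.
case/orP => h; first by rewrite (_ : eu a.1 s *m _ = 0) ?ltens0m ?mul_delta_mx_0.
by rewrite (_ : eu a.2 i *m _ = 0) ?ltens0l ?mul_delta_mx_0.
Qed.

(** A cannot separate u_1 from d_1, but D_0 vanishes on d_1, so only the part at u_1 survives; the
    zero first row of the beta matrix leaves the first M-index alone. *)
Lemma ClD_P_D (c d : 'I_2 * 'I_4) : c.2 != 0 -> @inAC R (tunit c d 1%:M) ->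
  Cl ((Xa 0 c.2 * eu 0 0 0 c.1 + Y 0 c.2 * eu 0 1 0 c.1) *: tunit (0, 0) d e1).
Proof.
case: c => s j /= hj hc.
have hne t : (t, 0) != (s, j) by rewrite xpair_eqE (eq_sym 0) (negPf hj) andbF.
have /(ClD_off_diagonal (inAC_P R) hc) :
    (tunit (0, 0) (0, 0) 1%:M + tunit (1, 0) (1, 0) 1%:M)
      * tunit (s, j) d 1%:M = 0 :> op.
  by rewrite mulrDl !tunit_orth ?addr0 ?hne.
set u := tunit (0, 0) (0, 0) 1%:M; set v := tunit (1, 0) (1, 0) 1%:M.
rewrite !mulrDl !tunit_D0red /=.
have X0 k : Xb 0 k = 0 by elim/ord4P: k; rewrite mxE.
have Y0 k : mdag Y 0 k = 0 by elim/ord4P: k; rewrite !mxE /= ?oppr0.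
have z1 : eu 0 0 1 s = 0 :> R[i] by rewrite mxE.
have z2 : eu 0 1 1 s = 0 :> R[i] by rewrite mxE.
by rewrite !X0 !Y0 z1 z2 !mul0r !mulr0 !addr0 !scale0r !addr0.
Qed.

Lemma ClD_u1_D (c d : 'I_2 * 'I_4) : (0, 1) != c -> @inAC R (tunit c d 1%:M) ->
  Cl ((Xa 1 c.2 * eu 0 0 0 c.1 + Y 1 c.2 * eu 0 1 0 c.1) *: tunit (0, 1) d e1
      + (Xb 1 c.2 * eu 0 0 0 c.1) *: tunit (0, 1) d rest).
Proof.
move=> hne hc.
have := ClD_off_diagonal (inAC_u1 R) hc (tunit_orth _ _ _ _ hne).
by rewrite tunit_D0red [eu 1 0 _ _]mxE mulr0 addr0.
Qed.

Notation U2 := (Ordinal (isT : 2 < 4)%N).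
Notation U3 := (Ordinal (isT : 3 < 4)%N).

(** One non-zero entry is enough: the units of A on {u_3, u_4} move it to any target and the scalar
    is divided out. *)
Lemma linked_a1 (k : 'I_4) : (a13, a14) != (0, 0) -> (1 < k)%N ->
  linked (0, 0) (0, k).
Proof.
rewrite xpair_eqE negb_and => h hk.
have K (j : 'I_4) : j != 0 -> (1 < j)%N -> Xa 0 j != 0 -> linked (0, 0) (0, k).
  move=> hj0 hj hX; have := @ClD_P_D (0, j) (0, k) hj0 (inAC_u R hj hk).
  by rewrite !mxE /= mulr1 mulr0 addr0; apply: ClD_unscale; move: hX; rewrite mxE.
by case/orP: h => h; [apply: (K U2)|apply: (K U3)] => //; rewrite mxE.
Qed.

Lemma linked_d1 (k : 'I_4) : (d12, d13, d14) != (0, 0, 0) -> (0 < k)%N ->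
  linked (0, 0) (1, k).
Proof.
rewrite !xpair_eqE !negb_and => h hk.
have K (j : 'I_4) : j != 0 -> (0 < j)%N -> Y 0 j != 0 -> linked (0, 0) (1, k).
  move=> hj0 hj hX; have := @ClD_P_D (1, j) (1, k) hj0 (inAC_d R hj hk).
  by rewrite !mxE /= mulr1 mulr0 add0r; apply: ClD_unscale; move: hX; rewrite mxE.
by case/orP: h => [/orP[]|] h; [apply: (K 1)|apply: (K U2)|apply: (K U3)] => //;
  rewrite mxE.
Qed.

Lemma linked_d2 (k : 'I_4) : (d22, d23, d24) != (0, 0, 0) -> (0 < k)%N ->
  linked (0, 1) (1, k).
Proof.
rewrite !xpair_eqE !negb_and => h hk.
have K (j : 'I_4) : (0 < j)%N -> Y 1 j != 0 -> linked (0, 1) (1, k).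
  move=> hj hX; have := @ClD_u1_D (1, j) (1, k) isT (inAC_d R hj hk).
  rewrite !mxE /= !mulr0 scale0r addr0 mulr1 add0r; apply: ClD_unscale.
  by move: hX; rewrite mxE.
by case/orP: h => [/orP[]|] h; [apply: (K 1)|apply: (K U2)|apply: (K U3)] => //;
  rewrite mxE.
Qed.

Lemma ClD_u1_u (j k : 'I_4) : (1 < j)%N -> (1 < k)%N ->
  Cl (Xa 1 j *: tunit (0, 1) (0, k) e1 + Xb 1 j *: tunit (0, 1) (0, k) rest).
Proof.
move=> hj hk; have hne : (0, 1) != (0, j) :> 'I_2 * 'I_4.
  by rewrite xpair_eqE /= -val_eqE /=; case: eqP hj => // <-.
have := @ClD_u1_D (0, j) (0, k) hne (inAC_u R hj hk).
by rewrite /= [eu 0 1 0 0]mxE [eu 0 0 0 0]mxE !mulr1 mulr0 addr0.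
Qed.

Lemma tunit0 a b : tunit a b 0 = 0 :> op.
Proof. by rewrite /tunit -(scale0r 0) ltensZr scale0r. Qed.

Lemma tunit_e1_rest a b c : tunit a b e1 * tunit b c rest = 0.
Proof. by rewrite tunitM mulmxBr mulmx1 e1M subrr tunit0. Qed.

Lemma tunit_rest_e1 a b c : tunit a b rest * tunit b c e1 = 0.
Proof. by rewrite tunitM mulmxBl mul1mx e1M subrr tunit0. Qed.

(** The corner between u_2 and {u_3, u_4} mixes alpha on the first M-index with beta on the others.
    Separating them takes a projection [e1] at one end, so one end must have been reached before. *)
Lemma linked_a2 (k : 'I_4) : (a23, a24) != (0, 0) ->
  linked (0, 1) (0, 1) \/ (forall j : 'I_4, (1 < j)%N -> linked (0, j) (0, j)) ->
  (1 < k)%N -> linked (0, 1) (0, k).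
Proof.
rewrite !xpair_eqE !negb_and => h hl hk.
have K (j : 'I_4) : (1 < j)%N -> Xa 1 j != 0 -> linked (0, 1) (0, k).
  move=> hj hX; apply: ClD_unscale (hX) _; case: hl => [hl|/(_ k hk) hl].
  - have := gen_mul hl (ClD_u1_u hj hk).
    by rewrite mulrDr -!scalerAr tunit_e1_rest scaler0 addr0 tunitM e1M.
  - have := gen_mul (ClD_u1_u hj hk) hl.
    by rewrite mulrDl -!scalerAl tunit_rest_e1 scaler0 addr0 tunitM e1M.
by case/orP: h => h; [apply: (K U2)|apply: (K U3)] => //; rewrite mxE.
Qed.

Definition linked_rest (a b : 'I_2 * 'I_4) := Cl (tunit a b rest).

Lemma linked_rest_sym a b : linked_rest a b -> linked_rest b a.
Proof.
move/gen_adj; rewrite tunit_adj (_ : mdag rest = rest) //.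
apply/matrixP => i j; rewrite !mxE (eq_sym j) (andbC (j == 0)).
by rewrite rmorphB !(rmorph_nat (@conjc R)).
Qed.

Lemma linked_rest_trans b a c :
  linked_rest a b -> linked_rest b c -> linked_rest a c.
Proof.
move=> h1 h2; have := gen_mul h1 h2.
by rewrite tunitM mulmxBr mulmx1 mulmxBl mul1mx e1M subrr subr0.
Qed.

Lemma linked_rest_split a b :
  @inAC R (tunit a b 1%:M) -> linked a b -> linked_rest a b.
Proof.
move=> /inAC_ClD h1 h2; have := ClDB h1 h2.
suff -> : tunit a b 1%:M - tunit a b e1 = tunit a b rest by [].
by rewrite /tunit ltensDr -[- eu 0 0]scaleN1r ltensZr scaleN1r.
Qed.

(** * Sufficiency: three edges connect the graph *)

Hypothesis hb : (b23, b24) != (0, 0).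
Hypothesis hg : leq 3 (nat_of_bool ((a13, a14) != (0%R, 0%R))
           + nat_of_bool ((a23, a24) != (0%R, 0%R))
           + nat_of_bool ((d12, d13, d14) != (0%R, 0%R, 0%R))
           + nat_of_bool ((d22, d23, d24) != (0%R, 0%R, 0%R)))%N.

(** Five sets of edges remain, and each contains a path from u_1 to every vertex. Where alpha_2 is
    used, one of its ends has already been reached by another edge. *)
Lemma linked_all_from :
  [/\ linked (0, 0) (0, 1), forall k : 'I_4, (1 < k)%N -> linked (0, 0) (0, k)
    & forall k : 'I_4, (0 < k)%N -> linked (0, 0) (1, k)].
Proof.
have := hg; have AU h j hj := linked_refl (@linked_a1 j h hj).
have [_|h1] := eqVneq (a13, a14) (0, 0); have [_|h2] := eqVneq (a23, a24) (0, 0);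
  have [_|h3] := eqVneq (d12, d13, d14) (0, 0, 0);
  have [_|h4] := eqVneq (d22, d23, d24) (0, 0, 0) => //= _.
- have D2 := linked_sym (linked_d2 (k := 1) h4 isT).
  have A1 := linked_trans (linked_d1 (k := 1) h3 isT) D2.
  split=> // k hk; last exact: linked_d1.
  by apply: (linked_trans A1); apply: linked_a2 => //; left; exact: linked_refl A1.
- have D2 := linked_sym (linked_d2 (k := 1) h4 isT).
  have A1 := linked_trans (linked_d1 (k := 1) h3 isT) D2.
  by split=> // k hk; [exact: linked_a1|exact: linked_d1].
- have A2 := linked_sym (linked_a2 (k := U2) h2 (or_intror (AU h1)) isT).
  have A1 := linked_trans (linked_a1 (k := U2) h1 isT) A2.
  by split=> // k hk; [exact: linked_a1|apply: linked_trans A1 _; exact: linked_d2].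
- have A2 := linked_sym (linked_a2 (k := U2) h2 (or_intror (AU h1)) isT).
  have A1 := linked_trans (linked_a1 (k := U2) h1 isT) A2.
  by split=> // k hk; [exact: linked_a1|exact: linked_d1].
- have D2 := linked_sym (linked_d2 (k := 1) h4 isT).
  have A1 := linked_trans (linked_d1 (k := 1) h3 isT) D2.
  by split=> // k hk; [exact: linked_a1|exact: linked_d1].
Qed.

Lemma linked_all (s t : 'I_2) (j k : 'I_4) :
  (s == 0) || (j != 0) -> (t == 0) || (k != 0) -> linked (s, j) (t, k).
Proof.
have [A1 AU AD] := linked_all_from.
have K (u : 'I_2) (i : 'I_4) : (u == 0) || (i != 0) -> linked (0, 0) (u, i).
  elim/ord2P: u => /= hi; last by apply: AD; rewrite lt0n.
  elim/ord4P: i hi => _; [|exact: A1|exact: AU|exact: AU].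
  exact: linked_trans A1 (linked_sym A1).
by move=> /K h1 /K h2; exact: linked_trans (linked_sym h1) h2.
Qed.

(** All links on the first M-index are now available, so the alpha term can be subtracted from the
    mixed corner, leaving beta. *)
Lemma linked_rest_u (j k : 'I_4) : j != 0 -> k != 0 -> linked_rest (0, j) (0, k).
Proof.
have K (i : 'I_4) : (1 < i)%N -> linked_rest (0, 1) (0, i).
  have := hb; rewrite !xpair_eqE !negb_and => h hi.
  have {}K (l : 'I_4) : (1 < l)%N -> Xb 1 l != 0 -> linked_rest (0, 1) (0, i).
    move=> hl hX; apply: ClD_unscale (hX) _.
    have L : linked (0, 1) (0, i) by apply: linked_all.
    have := ClDB (ClD_u1_u hl hi) (gen_scale (Xa 1 l) L).
    by rewrite addrAC subrr add0r.
  by case/orP: h => h; [apply: (K U2)|apply: (K U3)] => //; rewrite mxE.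
have {}K (i : 'I_4) : i != 0 -> linked_rest (0, 1) (0, i).
  elim/ord4P: i => // _; [|exact: K|exact: K].
  by apply: linked_rest_trans (K U2 isT) (linked_rest_sym (K U2 isT)).
by move=> /K h1 /K h2; exact: linked_rest_trans (linked_rest_sym h1) h2.
Qed.

Lemma linked_rest_d (j k : 'I_4) : j != 0 -> k != 0 -> linked_rest (1, j) (1, k).
Proof.
move=> hj hk; apply: linked_rest_split; last exact: linked_all.
by apply: inAC_d; rewrite lt0n.
Qed.

(** * Matrix units of End(K) as elementary tensors *)

Lemma llabW_eq r p : blk p = 0%N -> (llab r == p) = (r == p).
Proof.
move=> hp; apply/eqP/eqP => [h|->]; last exact: llabW.
by rewrite -h llabW // -llab_blk h.
Qed.

Lemma llabU_eq (s a : 'I_2) (i b c : 'I_4) : i != 0 ->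
  (llab (a, b, c) == (s, i, 1)) = [&& a == s, b == i & c != 0].
Proof.
move=> hi; rewrite /llab /blk; elim/ord2P: a; elim/ord2P: s;
  have [->|hb0] := eqVneq b 0; have [->|hc] := eqVneq c 0;
  by rewrite /= ?xpair_eqE /= ?andbF ?(negPf hi) ?(eq_sym 0) ?(negPf hi) ?andbT.
Qed.

Lemma left_unitW s i t k : (s == 0) || (i != 0) -> (t == 0) || (k != 0) ->
  left_unit R (s, i, 0) (t, k, 0) = tunit (s, i) (t, k) e1.
Proof.
move=> hp hq; apply: ent_inj => -[[a b] c] [[a' b'] c'].
rewrite ent_op_of !llabW_eq ?blkW // ent_ltens !mxE /= -!natrM !mulnb.
congr (_%:R); congr nat_of_bool; apply/idP/idP.
  by move=> /and3P[_ /eqP[-> -> ->] /eqP[-> -> ->]]; rewrite !eqxx.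
case/andP=> /andP[/andP[/eqP-> /eqP->] /andP[/eqP-> /eqP->]] /andP[/eqP-> /eqP->].
by have /= -> := blkW hp; have /= -> := blkW hq; rewrite !eqxx.
Qed.

(** On block 1 the factor K is a line, so its one unit is the projection onto the block: the rows
    u_1 and d_1 without u_1 r_1. *)
Lemma left_unitV : left_unit R (1, 0, 0) (1, 0, 0) =
  tunit (0, 0) (0, 0) 1%:M + tunit (1, 0) (1, 0) 1%:M - tunit (0, 0) (0, 0) e1.
Proof.
apply: ent_inj => -[[s i] j] [[s' i'] j'].
rewrite ent_op_of !entD entN !ent_ltens !mxE /llab /rlab /blk.
elim/ord2P: s; elim/ord2P: s' => /=; have [->|hi] := eqVneq i 0;
  have [->|hi'] := eqVneq i' 0; have [->|hj] := eqVneq j 0;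
  have [->|hj'] := eqVneq j' 0.
all: rewrite /= ?xpair_eqE /=
  ?(mulr0, mul0r, mulr1, addr0, add0r, subr0, subrr) ?andbF //.
all: by rewrite ?eqxx ?(negPf hi) ?(negPf hi') ?(negPf hj) ?(negPf hj')
  ?(eq_sym 0) ?(negPf hj') ?(negPf hi') /=
  ?(mulr0, mul0r, mulr1, addr0, add0r, subr0, subrr) ?andbT ?mul1r.
Qed.

Lemma left_unitU s i k : i != 0 -> k != 0 ->
  left_unit R (s, i, 1) (s, k, 1) = tunit (s, i) (s, k) rest.
Proof.
move=> hi hk; apply: ent_inj => -[[a b] c] [[a' b'] c'].
have B (l e : 'I_4) : l != 0 -> e != 0 -> rlab (s, l, e) = (s, 1, e).
  by move=> hl he; rewrite /rlab blkU.
rewrite ent_op_of !llabU_eq // ent_ltens !mxE -[(s, i).1]/s -[(s, k).1]/s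
  -[(s, i).2]/i -[(s, k).2]/k.
have [->|_] := eqVneq a s; last by rewrite /= !(andbF, mulr0, mul0r).
have [->|_] := eqVneq a' s; last by rewrite /= !(andbF, mulr0, mul0r).
have [->|_] := eqVneq b i; last by rewrite /= !(andbF, mulr0, mul0r).
have [->|_] := eqVneq b' k; last by rewrite /= !(andbF, mulr0, mul0r).
rewrite !mulr1 mul1r; have [->|hc] := eqVneq c 0.
  by rewrite /= andbF eq_sym subrr.
have [->|hc'] := eqVneq c' 0; first by rewrite /= !andbF (negPf hc) subr0.
by rewrite !B // !xpair_eqE !eqxx /= andbT subr0.
Qed.

Lemma left_unit_ClD p q : llab p = p -> llab q = q -> rlab p = rlab q ->
  Cl (left_unit R p q).
Proof.
elim/blkP: p => [s i h|s i j h|s i j hi hj];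
  elim/blkP: q => [s' i' h'|s' i' j' h'|s' i' j' hi' hj'] => hp hq hm;
  have := blk_rlab hm;
  rewrite ?(blkW h) ?(blkW h') ?(blkV h) ?(blkV h') ?blkU // => hbl.
- by rewrite left_unitW //; apply: linked_all.
- move: hp hq; rewrite /llab (blkV h) (blkV h') => <- <-; rewrite left_unitV.
  by apply: ClDB; [exact/inAC_ClD/inAC_P|exact: linked_all].
- have hs : s = s' by move: hbl; elim/ord2P: (s); elim/ord2P: (s').
  move: hp hq; rewrite /llab !blkU //= => -[<-] [<-]; rewrite -hs left_unitU //.
  by elim/ord2P: (s); [exact: linked_rest_u|exact: linked_rest_d].
Qed.

Lemma graph_Hodge : Hodge Dred.
Proof.
apply: left_ClD_Hodge => T /left_op_span ->.
apply: big_ind.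
(* [gen_salg] has no constructor for zero, which is reached as a zero multiple of a member. *)
- rewrite -(scale0r (left_unit R (0, 0, 0) (0, 0, 0))).
  by apply/gen_scale/left_unit_ClD.
- by move=> U V; exact: gen_add.
- by case=> p q /= /and3P[/eqP hp /eqP hq /eqP hm]; apply/gen_scale/left_unit_ClD.
Qed.

End DiracOperator.

Theorem theorem18 (R : realType)
  (a13 a14 a23 a24 b13 b14 b23 b24 d12 d13 d14 d21 d22 d23 d24 ups : R[i]) :
  d21 = 0 -> b13 = 0 -> b14 = 0 ->
  (Hodge (Dirac a13 a14 a23 a24 b13 b14 b23 b24 d12 d13 d14 d21 d22 d23 d24 ups)
   <->
   ((b23, b24) != (0, 0)) /\
   leq 3 (nat_of_bool ((a13, a14) != (0%R, 0%R))
           + nat_of_bool ((a23, a24) != (0%R, 0%R))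
           + nat_of_bool ((d12, d13, d14) != (0%R, 0%R, 0%R))
           + nat_of_bool ((d22, d23, d24) != (0%R, 0%R, 0%R)))%N).
Proof.
move=> -> -> ->; rewrite Dirac_Dred; split=> [|[hb hg]]; first exact: Hodge_graph.
exact: graph_Hodge.
Qed.
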